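(* Let $p$ be a prime, let $0,\alpha,\beta$ be distinct integers, and let $R=\mathbb{Z}_p[x]/x(x-\alpha)(x-\beta)\mathbb{Z}_p[x]$. If $([\alpha],[\beta],[\beta-\alpha])=(1,1,1)$, then, writing $x=p^{-s}$, $$(1-x)^3\zeta_R(s)=p^3x^6-2p^2x^5+(p^2+p)x^4+(p^2-2p)x^3+(p+1)x^2-2x+1.$$
   Context: $\mathbb{Z}_p=\{a/b\mid a,b\in\mathbb{Z},\ p\nmid b\}$ is the localization of $\mathbb{Z}$ at $p$. For nonzero $a\in\mathbb{Z}_p$, $[a]$ is the unique non-negative integer $r$ with $a\mathbb{Z}_p=p^r\mathbb{Z}_p$. $\zeta_R(s)=\sum_I |R:I|^{-s}$, where $I$ runs over the full ideals of $R$ (ideals of finite index), viewed as a formal power series in $p^{-s}$. In the formula $x$ denotes $p^{-s}$ (not the polynomial variable). *)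

(* Defs.v *)
From HB Require Import structures.
From mathcomp Require Import all_boot all_order all_algebra.
From mathcomp Require Import boolp classical_sets cardinality.

Set Implicit Arguments.
Unset Strict Implicit.
Unset Printing Implicit Defensive.

Import Order.TTheory GRing.Theory Num.Theory.
Local Open Scope classical_set_scope.
Local Open Scope card_scope.
Local Open Scope ring_scope.

(* The primality proof is a parameter so that the ring structure on Zloc can be
   inferred from the type. *)
Definition Zloc_pred (p : nat) (p_prime : prime p) : {pred rat} :=
  fun r => `[< exists a b : int, ~~ (p%:Z %| b)%Z /\ r = a%:Q / b%:Q >].

Section Localization.
Variables (p : nat) (p_prime : prime p).
Local Notation Zloc_pred := (Zloc_pred p_prime).

Lemma Zloc_predP (r : rat) :
  reflect (exists a b : int, ~~ (p%:Z %| b)%Z /\ r = a%:Q / b%:Q)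
          (r \in Zloc_pred).
Proof. exact: asboolP. Qed.

Lemma Zloc_dvdzM (b d : int) :
  ~~ (p%:Z %| b)%Z -> ~~ (p%:Z %| d)%Z -> ~~ (p%:Z %| b * d)%Z.
Proof. by rewrite !dvdzE abszM /= Euclid_dvdM // => /negPf-> /negPf->. Qed.

Lemma Zloc_denN0 (b : int) : ~~ (p%:Z %| b)%Z -> b%:Q != 0.
Proof. by apply: contraNneq => /eqP; rewrite intr_eq0 => /eqP->; exact: dvdz0. Qed.

Fact Zloc_subring_closed : subring_closed Zloc_pred.
Proof.
split.
- apply/Zloc_predP; exists 1, 1; split; last by rewrite divr1.
  by rewrite dvdzE /= dvdn1 neq_ltn prime_gt1 ?orbT.
- move=> _ _ /Zloc_predP[a [b [hb ->]]] /Zloc_predP[c [d [hd ->]]].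
  apply/Zloc_predP; exists (a * d - c * b), (b * d).
  split; first exact: Zloc_dvdzM.
  by rewrite -mulNr addf_div ?Zloc_denN0 // rmorphB /= !rmorphM /= mulNr.
- move=> _ _ /Zloc_predP[a [b [hb ->]]] /Zloc_predP[c [d [hd ->]]].
  apply/Zloc_predP; exists (a * c), (b * d).
  split; first exact: Zloc_dvdzM.
  by rewrite mulf_div !rmorphM.
Qed.

HB.instance Definition _ :=
  GRing.isSubringClosed.Build rat Zloc_pred Zloc_subring_closed.

Record Zloc : predArgType :=
  MkZloc { Zloc_val :> rat; _ : Zloc_val \in Zloc_pred }.

HB.instance Definition _ := [isSub for Zloc_val].
HB.instance Definition _ := [Choice of Zloc by <:].
HB.instance Definition _ := [SubChoice_isSubComNzRing of Zloc by <:].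

(* The value [a]; it is only meaningful for a != 0 (it is 0 for a = 0). *)
Definition Zloc_ord (a : Zloc) : nat :=
  xget 0%N [set r : nat |
    range (fun u : Zloc => a * u) = range (fun u : Zloc => p%:R ^+ r * u)].

(* {poly %/ h} is the quotient by h only when h is monic of size > 1;
   see mk_monic_cubic below. *)
Definition cubic (a b : int) : {poly Zloc} :=
  'X * ('X - (a%:~R)%:P) * ('X - (b%:~R)%:P).

Lemma mk_monic_cubic (a b : int) : mk_monic (cubic a b) = cubic a b.
Proof.
have cm : cubic a b \is monic.
  by rewrite /cubic !(rpredM, monicX, monicXsubC).
have cs : size (cubic a b) = 4%N.
  rewrite /cubic size_Mmonic ?monicXsubC //; last first.
    by rewrite monic_neq0 // rpredM ?monicX ?monicXsubC.
  rewrite size_Mmonic ?monicXsubC ?monic_neq0 ?monicX //.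
  by rewrite size_polyX !size_XsubC.
by rewrite /mk_monic cs cm.
Qed.

End Localization.

Section IdealZeta.
Variable R : comNzRingType.

Definition is_ideal (I : set R) : Prop :=
  [/\ I 0, forall x y, I x -> I y -> I (x + y)
    & forall a x, I x -> I (a * x)].

Definition cosets (I : set R) : set (set R) :=
  range (fun x : R => [set y | I (y - x)]).

Definition full_ideal (I : set R) : Prop :=
  is_ideal I /\ finite_set (cosets I).

Definition has_index (I : set R) (m : nat) : Prop := cosets I #= `I_m.

(* The Dirichlet series \sum_I |R : I|^(-s) over the full ideals I equals the
   power series \sum_n z n * x^n in x = p^(-s): only powers of p occur as
   indices, and z n is the (finite) number of full ideals of index p^n. *)
Definition zeta_series (p : nat) (z : nat -> nat) : Prop :=
  (forall I : set R, full_ideal I -> exists n, has_index I (p ^ n)%N) /\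
  (forall n, [set I : set R | full_ideal I /\ has_index I (p ^ n)%N] #= `I_(z n)).

End IdealZeta.

Definition fps_of_poly (P : {poly int}) : nat -> int := fun n => P`_n.

Definition fps_mul (f g : nat -> int) : nat -> int :=
  fun n => \sum_(i < n.+1) f i * g (n - i)%N.

(* Main.v *)
Require Import Defs.
From HB Require Import structures.
From mathcomp Require Import all_boot all_order all_algebra.
From mathcomp Require Import boolp classical_sets cardinality.
From mathcomp Require Import ring zify.

(* Write alpha = p a, beta = p b, c = b - a; the hypothesis says that a, b, c are
   units of A = Z_p. A full ideal is an A-lattice stable under X, so in the basis
   1, X, X (X - alpha) it has a Hermite basis
     g0 = (p^i, u, v), g1 = (0, p^j, w), g2 = (0, 0, p^k),
   and stability under X reads
     p^i + alpha u = p^j s,  p^j + (beta - alpha) w = p^k t,  u + beta v - s w = p^k r.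
   As alpha, beta and beta - alpha are p times units, u mod p^j, w mod p^k and
   v mod p^k are determined by s, t, r mod p, so the ideals with given exponents
   i, j, k >= 1 correspond to those triples of residues for which u - s w is
   divisible by p. This is one quadratic condition on (s, t), which depends only
   on which of i, j, k equal 1; counting its solutions gives the zeta function. *)

Set Implicit Arguments.
Unset Strict Implicit.
Unset Printing Implicit Defensive.

Import Order.TTheory GRing.Theory Num.Theory.
Local Open Scope ring_scope.

Lemma natr_Fp (p : nat) (s : 'F_p) : (s : nat)%:R = s.
Proof. exact: natr_Zp. Qed.

(** * The localization of Z at p *)

Section LocalizationFacts.
Variables (p : nat) (p_prime : prime p).
Local Notation A := (Zloc p_prime).

Lemma Zloc_val_int (m : int) : Zloc_val (m%:~R : A) = m%:~R.
Proof. exact: (rmorph_int (\val : A -> rat)). Qed.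

Lemma Zloc_frac (x : A) :
  exists a b : int, ~~ (p%:Z %| b)%Z /\ b%:~R * x = a%:~R.
Proof.
have /Zloc_predP[a [b [pb xE]]] := valP x.
exists a, b; split=> //; apply: val_inj.
rewrite (rmorphM (\val : A -> rat)) /= !Zloc_val_int.
by rewrite [Zloc_val x]xE mulrC divfK // (Zloc_denN0 (p := p)).
Qed.

Lemma Zloc_unit_int (b : int) : ~~ (p%:Z %| b)%Z -> exists y : A, b%:~R * y = 1.
Proof.
move=> pb; have yP : (1 / b%:~R : rat) \in Zloc_pred p_prime.
  by apply/Zloc_predP; exists 1, b.
exists (MkZloc yP); apply: val_inj.
by rewrite (rmorphM (\val : A -> rat)) /= !Zloc_val_int mul1r divff // (Zloc_denN0 (p := p)).
Qed.

Lemma Zloc_natp_lreg : GRing.lreg (p%:R : A).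
Proof.
move=> x y /(congr1 (\val : A -> rat)); rewrite !(rmorphM (\val : A -> rat)) /=.
rewrite -[p%:R]/(p%:~R : A) Zloc_val_int => /mulfI pI.
by apply/val_inj/pI; rewrite intr_eq0 -lt0n prime_gt0.
Qed.

(** Writing y = a / b gives b m = p a over the integers, where p does not divide b. *)
Lemma Zloc_natp_dvd_int (m : int) (y : A) : m%:~R = p%:R * y -> (p%:Z %| m)%Z.
Proof.
have [a [b [pb yE]]] := Zloc_frac y => mE.
have : (b * m)%:~R = (p%:Z * a)%:~R :> A.
  by rewrite !rmorphM /= mE -yE mulrCA.
move/(congr1 (\val : A -> rat)); rewrite /= !Zloc_val_int => /intr_inj bm.
by apply/negPn/negP => /(Zloc_dvdzM p_prime pb); rewrite bm dvdz_mulr.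
Qed.

Lemma Zloc_residue (x : A) : exists (s : 'F_p) (y : A), x = (s : nat)%:R + p%:R * y.
Proof.
have [a [b [pb xE]]] := Zloc_frac x.
have [y by1] := Zloc_unit_int pb.
have bF : (b%:~R : 'F_p) != 0.
  apply: contra pb; rewrite -(dvdz_pcharf (pchar_Fp p_prime)) //.
(* The digit is the residue of x = a / b; then p divides a - b s, and b is invertible in A. *)
pose s : 'F_p := a%:~R / b%:~R.
have /dvdzP[m mE] : (p%:Z %| a - b * (s : nat)%:Z)%Z.
  rewrite (dvdz_pcharf (pchar_Fp p_prime)) rmorphB rmorphM /= (natr_Fp s : (s : nat)%:~R = s).
  by rewrite mulrC divfK // subrr.
exists s, (m%:~R * y).
have -> : p%:R * (m%:~R * y) = (m * p%:Z)%:~R * y by rewrite rmorphM /= mulrCA mulrA.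
rewrite -mE rmorphB rmorphM /= -xE -pmulrn.
by rewrite -mulrBr mulrAC by1 mul1r addrCA subrr addr0.
Qed.

Lemma Zloc_local (x : A) : (exists y, x = p%:R * y) \/ (exists y, x * y = 1).
Proof.
have [a [b [pb xE]]] := Zloc_frac x.
have [y by1] := Zloc_unit_int pb.
have xE' : x = a%:~R * y by rewrite -xE mulrAC by1 mul1r.
have [/dvdzP[m mE]|pa] := boolP (p%:Z %| a)%Z.
  by left; exists (m%:~R * y); rewrite xE' mE rmorphM /= mulrAC mulrC.
have [z az1] := Zloc_unit_int pa; right; exists (b%:~R * z).
by rewrite xE' [b%:~R * z]mulrC mulrACA az1 mul1r mulrC.
Qed.

Lemma Zloc_ord1 (m : int) : Zloc_ord (m%:~R : A) = 1%N ->
  exists2 a : int, m = p%:Z * a & exists a' : A, a%:~R * a' = 1.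
Proof.
(* The default value 0 of [xget] differs from 1, so the two ranges do coincide: m = p u and p = m v,
   and [v] inverts a = m / p. *)
rewrite /Zloc_ord; case: xgetP => // r -> /= + r1; rewrite r1 expr1 => rangeE.
have [u _ uE] : range (fun u : A => p%:R * u) m%:~R.
  by rewrite -rangeE; exists 1 => //; rewrite mulr1.
have [v _ vE] : range (fun u : A => m%:~R * u) p%:R.
  by rewrite rangeE; exists 1 => //; rewrite mulr1.
have /dvdzP[a mE] := Zloc_natp_dvd_int (esym uE).
exists a; first by rewrite mulrC.
exists v; apply: Zloc_natp_lreg.
by rewrite mulr1 -[RHS]vE mE rmorphM /= mulrA -[in RHS]mulrA mulrCA mulrA.
Qed.
End LocalizationFacts.

(** Turns a parametrization by finitely many data into a cardinality; it serves for the cosets of a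
    lattice and for the ideals of a given index. *)
Lemma card_eq_enum (T : finType) (U : Type) (D : {pred T}) (S : set U) (f : T -> U) :
  {in D &, injective f} -> (forall y, S y <-> exists2 x, x \in D & f x = y) ->
  (S #= `I_#|D|)%card.
Proof.
move=> f_inj SE.
have -> : S = [set f (enum_val i) | i in [set: 'I_#|D|]]%classic.
  apply/seteqP; split=> y.
    by move=> /SE[x xD <-]; exists (enum_rank_in xD x); rewrite ?enum_rankK_in.
  by move=> [i _ <-]; apply/SE; exists (enum_val i) => //; exact: enum_valP.
apply: card_eq_trans (card_esym card_II).
apply: inj_card_eq => i i' _ _ /f_inj eq_i.
by apply: enum_val_inj; apply: eq_i; exact: enum_valP.
Qed.

(** * Counting the digit triples *)

Section Digits.
Variables (p : nat) (a b : int).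

(* With a u = s p^(j-1) - p^(i-1) and c w = t p^(k-1) - p^(j-1), this is
   a c (u - s w). *)
Definition obstruction (i j k : nat) (s t : 'F_p) : int :=
  b * (s : nat) * p%:Z ^+ j.-1 - (b - a) * p%:Z ^+ i.-1
  - a * (s : nat) * (t : nat) * p%:Z ^+ k.-1.

(* For k = 0 the entries v, w are irrelevant, and so is u if moreover j = 0; the
   corresponding digits are then normalized to 0. *)
Definition valid_digits (i j k : nat) (s t r : 'F_p) : bool :=
  if k is 0 then [&& t == 0, r == 0 & if j is 0 then s == 0 else (0 < i)%N]
  else [&& (0 < i)%N, (0 < j)%N & (p%:Z %| obstruction i j k s t)%Z].

Definition digits_in (i j k : nat) : pred ('F_p * 'F_p * 'F_p) :=
  fun x => valid_digits i j k x.1.1 x.1.2 x.2.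

(** The exponent k is recovered as n - (i + j), since the index p^(i+j+k) has to be p^n. *)
Definition params (n : nat) : pred ('I_n.+1 * 'I_n.+1 * ('F_p * 'F_p * 'F_p)) :=
  fun x => (x.1.1 + x.1.2 <= n)%N && digits_in x.1.1 x.1.2 (n - (x.1.1 + x.1.2)) x.2.

Hypothesis p_prime : prime p.
Hypotheses (aF : (a%:~R : 'F_p) != 0) (bF : (b%:~R : 'F_p) != 0)
           (cF : ((b - a)%:~R : 'F_p) != 0).

Lemma card_params n : #|@params n| =
  (\sum_(i < n.+1) \sum_(j < n.+1 | (i + j <= n)%N) #|digits_in i j (n - (i + j))|)%N.
Proof.
rewrite -sum1_card (eq_bigl (fun x => true && @params n x)) //.
rewrite -(pair_big_dep xpredT (fun ij x => @params n (ij, x)) (fun _ _ => 1%N)) /=.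
rewrite -(pair_big xpredT xpredT (fun i j => \sum_(x | @params n (i, j, x)) 1)%N) /=.
apply: eq_bigr => i _; rewrite [RHS]big_mkcond /=; apply: eq_bigr => j _.
case: ifP => ij; last by rewrite big_pred0 // => x; rewrite /params /= ij.
by rewrite -sum1_card; apply: eq_bigl => x; rewrite /params /= ij.
Qed.

(* The condition that p divides the obstruction, solved for s; I, J, K stand for
   the tests i = 1, j = 1, k = 1. *)
Definition first_digit (I J K : bool) (t : 'F_p) : pred 'F_p :=
  fun s => s * (b%:~R * J%:R - a%:~R * K%:R * t) == (b - a)%:~R * I%:R.

Definition solutions (I J K : bool) : nat := \sum_(t : 'F_p) #|first_digit I J K t|.

Lemma card_digits0 i : #|digits_in i 0 0| = 1%N.
Proof.
rewrite -(card1 ((0, 0, 0) : 'F_p * 'F_p * 'F_p)).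
apply: eq_card => -[[s t] r]; rewrite ?inE unfold_in /digits_in /= !xpair_eqE.
by case: (s == 0); case: (t == 0); case: (r == 0).
Qed.

Lemma card_digits_i0 j k : (0 < j + k)%N -> #|digits_in 0 j k| = 0%N.
Proof.
case: k => [|k] jk; apply: eq_card0 => -[[s t] r] //.
by case: j jk => // j _; rewrite unfold_in /digits_in /= !andbF.
Qed.

Lemma card_digits_j0 i k : #|digits_in i 0 k.+1| = 0%N.
Proof. by apply: eq_card0 => -[[s t] r]; rewrite unfold_in /digits_in /= andbF. Qed.

Lemma card_digits1 i j : #|digits_in i.+1 j.+1 0| = p.
Proof.
rewrite -[RHS](card_Fp p_prime).
rewrite -(card_imset predT (_ : injective (fun s : 'F_p => (s, 0 : 'F_p, 0 : 'F_p)))).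
  apply: eq_card => -[[s t] r]; rewrite ?inE unfold_in /digits_in /= andbT.
  apply/andP/imsetP => [[/eqP-> /eqP->]|[s' _ [_ -> ->]]]; last by rewrite eqxx.
  by exists s.
by move=> s s' [].
Qed.

(** Modulo p the power p^(j-1) is 1 for j = 1 and 0 for j > 1, so only the tests for exponent 1
    survive; the digit r is free and gives the factor p. *)
Lemma card_digits2 i j k : #|digits_in i.+1 j.+1 k.+1| =
  (solutions (i == 0) (j == 0) (k == 0) * p)%N.
Proof.
have pX n : (p%:R : 'F_p) ^+ n = (n == 0%N)%:R.
  by rewrite (pcharf0 (pchar_Fp p_prime)) expr0n.
have goodP s t r : digits_in i.+1 j.+1 k.+1 (s, t, r)
    = first_digit (i == 0) (j == 0) (k == 0) t s.
  rewrite /digits_in /first_digit /= (dvdz_pcharf (pchar_Fp p_prime)) /obstruction.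
  rewrite !rmorphB !rmorphM !rmorphXn /=.
  rewrite !(natr_Fp _ : (_ : nat)%:~R = _) -[p%:~R]/(p%:R) !pX.
  rewrite -[RHS]subr_eq0 rmorphB /=; congr (_ == 0); ring.
rewrite -sum1_card (eq_bigl (fun x => true && digits_in i.+1 j.+1 k.+1 x)) //.
rewrite -(pair_big_dep xpredT (fun st r => digits_in i.+1 j.+1 k.+1 (st, r))
  (fun _ _ => 1%N)) /=.
rewrite -(pair_big xpredT xpredT
  (fun s t => \sum_(r | digits_in i.+1 j.+1 k.+1 (s, t, r)) 1)%N) /=.
rewrite exchange_big /solutions big_distrl /=; apply: eq_bigr => t _.
rewrite -sum1_card big_distrl [RHS]big_mkcond /=; apply: eq_bigr => s _.
rewrite (eq_bigl _ _ (goodP s t)) mul1n.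
rewrite -[s \in _]/(first_digit (i == 0) (j == 0) (k == 0) t s).
case: (first_digit _ _ _ t s); last by rewrite big_pred0.
by rewrite -[RHS](card_Fp p_prime) -sum1_card.
Qed.

(** The equation is linear in s. Where its coefficient vanishes, it holds for every s or for none,
    according to I, because b - a is nonzero mod p. *)
Lemma card_first_digit I J K t : #|first_digit I J K t| =
  if b%:~R * J%:R - a%:~R * K%:R * t == 0 then if I then 0%N else p else 1%N.
Proof.
case: eqP => [y0|/eqP y0].
  case: I; last rewrite -[RHS](card_Fp p_prime).
    apply: eq_card0 => s; rewrite ?inE unfold_in /first_digit y0 mulr0 mulr1 eq_sym.
    exact: negPf.
  by apply: eq_card => s; rewrite ?inE unfold_in /first_digit y0 !mulr0 eqxx.
rewrite -(card1 ((b - a)%:~R * I%:R / (b%:~R * J%:R - a%:~R * K%:R * t))).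
apply: eq_card => s; rewrite [RHS]inE unfold_in.
exact: (can2_eq (mulfK y0) (mulfVK y0)).
Qed.

Lemma solutions0 I J : solutions I J false =
  if J then p else if I then 0%N else (p * p)%N.
Proof.
rewrite /solutions (eq_bigr (fun _ => if J then 1%N else if I then 0%N else p)).
  rewrite sum_nat_const card_Fp //.
  by case: J; [rewrite muln1|case: I; rewrite ?muln0].
move=> t _; rewrite card_first_digit mulr0 mul0r subr0.
by case: J; rewrite ?mulr1 ?mulr0 ?eqxx // (negPf bF).
Qed.

(** The coefficient b J - a t of s vanishes for exactly one t; each of the other p - 1 values of t
    gives one s. *)
Lemma solutions1 I J : solutions I J true = (p.-1 + if I then 0 else p)%N.
Proof.
pose t0 : 'F_p := b%:~R * J%:R / a%:~R.
rewrite /solutions (bigD1 t0) //= addnC card_first_digit mulr1.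
rewrite [a%:~R * _]mulrC divfK // subrr eqxx; congr (_ + _)%N.
rewrite (eq_bigr (fun _ => 1%N)).
  by rewrite -[in RHS](card_Fp p_prime) -(cardC1 t0) -sum1_card.
move=> t tt0; rewrite card_first_digit mulr1 subr_eq0 ifN //.
by apply: contra tt0 => /eqP E; rewrite /t0 E mulrAC divff // mul1r.
Qed.

(** Number of digit triples for a fixed i >= 1 and all j + k = m, where [I] tests i = 1. The last
    case lists k = 0 and then, times p for the digit r: j = 1, the [m] values with j, k >= 2, and k
    = 1. *)
Definition row_sum (I : bool) (m : nat) : nat :=
  match m with
  | 0 => 1
  | 1 => p
  | 2 => p + (p.-1 + if I then 0 else p) * p
  | m.+3 => p + (p + m * (if I then 0 else p * p) + (p.-1 + if I then 0 else p)) * p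
  end%N.

Lemma card_row i m :
  (\sum_(j < m.+1) #|digits_in i.+1 j (m - j)|)%N = row_sum (i == 0%N) m.
Proof.
case: m => [|m]; first by rewrite big_ord1 card_digits0.
(* The term j = 0 is empty because k > 0, and the last term, k = 0, contributes p. *)
rewrite big_ord_recl card_digits_j0 add0n big_ord_recr /= subnn card_digits1.
case: m => [|m]; first by rewrite big_ord0.
rewrite addnC; case: m => [|m].
  by rewrite big_ord1 card_digits2 solutions1.
congr (_ + _)%N; rewrite big_ord_recl big_ord_recr /= !mulnDl addnA.
congr (_ + _ + _)%N.
- by rewrite card_digits2 solutions0.
- rewrite (eq_bigr (fun _ => (if i == 0 then 0 else p * p) * p)%N) => [|j _].
    by rewrite sum_nat_const card_ord mulnA.
  have -> : (m.+3 - bump 0 (bump 0 j) = (m - j.+1).+2)%N.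
    by rewrite /bump /= !add1n; have := ltn_ord j; lia.
  by rewrite card_digits2 solutions0.
- rewrite (_ : (m.+3 - _ = 1)%N); last by rewrite /bump /= !add1n; lia.
  by rewrite card_digits2 solutions1 -mulnDl.
Qed.

(** * The generating series of the counts *)

Lemma card_params0 : #|@params 0| = 1%N.
Proof. by rewrite card_params big_ord1 big_mkcond big_ord1 /= card_digits0. Qed.

(** The row i = 0 is empty since then j + k > 0; the row i = 1 is special, and the rows i >= 2 are
    summed in reverse order. *)
Lemma card_paramsS n : #|@params n.+1| = (row_sum true n + \sum_(m < n) row_sum false m)%N.
Proof.
rewrite card_params big_ord_recl big1 => [|j _]; last first.
  by rewrite card_digits_i0 // add0n; have := ltn_ord j; lia.
rewrite add0n (eq_bigr (fun i : 'I_n.+1 => row_sum (i == 0%N :> nat) (n - i))) => [|i _].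
  rewrite big_ord_recl subn0; congr (_ + _)%N.
  by rewrite [RHS](reindex_inj rev_ord_inj).
rewrite -card_row (big_ord_widen n.+2 (fun j => #|digits_in i.+1 j (n - i - j)|)); last lia.
apply: eq_big => [j|j _].
  by have := ltn_ord i; rewrite /= /bump /=; lia.
by rewrite subnDA subSS.
Qed.

(** Multiplication by (1 - x)^3 is the third difference, with z extended by 0 to negative
    indices. *)
Lemma fps_mul_cube (z : nat -> int) n : fps_mul (fps_of_poly ((1 - 'X) ^+ 3)) z n =
  z n - (if n is n'.+1 then 3 * z n' else 0) + (if n is n'.+2 then 3 * z n' else 0)
  - (if n is n'.+3 then z n' else 0).
Proof.
have cE k : fps_of_poly ((1 - 'X) ^+ 3) k =
    (k == 0%N)%:R - 3 * (k == 1%N)%:R + 3 * (k == 2%N)%:R - (k == 3%N)%:R.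
  have -> : (1 - 'X) ^+ 3 = 1 - 3 *: 'X + 3 *: 'X^2 - 'X^3 :> {poly int}.
    by rewrite !scaler_nat; ring.
  by rewrite /fps_of_poly !coefE.
rewrite /fps_mul; under eq_bigr do rewrite cE.
case: n => [|[|[|n]]]; rewrite !big_ord_recl ?big_ord0 /= ?/bump /= ?subSS ?subn0.
- by ring.
- by ring.
- by ring.
by rewrite big1 => [|i _]; rewrite /=; ring.
Qed.

Lemma params_series :
  fps_mul (fps_of_poly ((1 - 'X) ^+ 3)) (fun n => (#|@params n|)%:Z) =
    fps_of_poly
      (p%:R ^+ 3 *: 'X^6 - (2 * p%:R ^+ 2) *: 'X^5 + (p%:R ^+ 2 + p%:R) *: 'X^4
       + (p%:R ^+ 2 - 2 * p%:R) *: 'X^3 + (p%:R + 1) *: 'X^2 - 2 *: 'X + 1).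
Proof.
apply/funext => n; rewrite fps_mul_cube /fps_of_poly !coefE.
have pE : Posz p.-1 = p%:Z - 1 by have := prime_gt0 p_prime; lia.
rewrite natz.
do 7 (case: n => [|n]; first by rewrite ?card_params0 ?card_paramsS
  ?big_ord_recr ?big_ord0 /= ?(PoszD, PoszM, pE); ring).
(* From index 7 on the right side is 0. The common part of the sums cancels and only rows with m >=
   3 remain, where [row_sum true] is constant and [row_sum false] affine; so the third difference
   vanishes. *)
rewrite !card_paramsS !(big_ord_recr n.+4.+1) !(big_ord_recr n.+4) !(big_ord_recr n.+3) /=.
rewrite !(PoszD, PoszM, pE); ring.
Qed.

End Digits.
(** * Ideals as lattices in Hermite form *)

Section IdealCount.
Variables (p : nat) (p_prime : prime p) (A : comNzRingType).
Local Notation P := (p%:R : A).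
(** The ring Z_p enters the lattice arguments through the next four properties only. *)
Hypothesis P_lreg : GRing.lreg P.
Hypothesis P_dvd_int : forall (m : int) (y : A), m%:~R = P * y -> (p%:Z %| m)%Z.
Hypothesis P_residue : forall x : A, exists (s : 'F_p) (y : A), x = (s : nat)%:R + P * y.
Hypothesis P_local : forall x : A, (exists y, x = P * y) \/ (exists y, x * y = 1).

Lemma expP_lreg n : GRing.lreg (P ^+ n).
Proof. by apply: GRing.lregX. Qed.

Lemma expP_mul0 n (x : A) : P ^+ n * x = 0 -> x = 0.
Proof. by move=> Px0; apply: (@expP_lreg n); rewrite mulr0. Qed.

Lemma expP_dvd_int n (m : int) (y : A) :
  m%:~R = P ^+ n * y -> (p%:Z ^+ n %| m)%Z.
Proof.
elim: n m => [|n IHn] m; first by rewrite dvd1z.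
rewrite exprS -mulrA => mE; have /dvdzP[m' m'E] := P_dvd_int mE.
rewrite m'E exprSr dvdz_mul2r ?IHn //; last by rewrite -lt0n prime_gt0.
by apply: P_lreg; rewrite -mE m'E rmorphM /= mulrC.
Qed.

Lemma expP_leq m n (y : A) : P ^+ m = P ^+ n * y -> (n <= m)%N.
Proof.
rewrite -natrX pmulrn => /expP_dvd_int.
by rewrite dvdzE abszX /= dvdn_Pexp2l // prime_gt1.
Qed.

(** The representative is built from its p-adic digits: s is the lowest one, m carries the
    others. *)
Lemma expP_residue n (x : A) :
  exists2 m, (m < p ^ n)%N & exists y, x = m%:R + P ^+ n * y.
Proof.
elim: n x => [|n IHn] x; first by exists 0%N => //; exists x; rewrite mul1r add0r.
have [s [y ->]] := P_residue x; have [m mn [z ->]] := IHn y.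
exists (s + p * m)%N; last by exists z; rewrite natrD natrM exprS; ring.
have sp : (s < p)%N by rewrite -[leqRHS](Fp_cast p_prime) ltn_ord.
have : (p * m.+1 <= p * p ^ n)%N by rewrite leq_mul2l mn orbT.
by rewrite expnS; apply: leq_trans; rewrite mulnS ltn_add2r.
Qed.

Lemma expP_residue_inj n m m' (y : A) : (m < p ^ n)%N -> (m' < p ^ n)%N ->
  m%:R - m'%:R = P ^+ n * y -> m = m'.
Proof.
move=> mn m'n mE; have /expP_dvd_int : (m%:Z - m'%:Z)%:~R = P ^+ n * y.
  by rewrite rmorphB.
have -> : p%:Z ^+ n = (p ^ n)%N by rewrite -[RHS]natz natrX natz.
rewrite -eqz_mod_dvd !modz_nat eqz_nat !modn_small //.
by move/eqP.
Qed.

(** The least power P^i in J divides all of J: if x = P^n y with n < i, then y is not a unit, as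
    otherwise P^n would lie in J, so P divides y. *)
Lemma uniformizer (J : A -> Prop) m : (forall r x, J x -> J (r * x)) -> J (P ^+ m) ->
  exists2 i, J (P ^+ i) & forall x, J x -> exists y, x = P ^+ i * y.
Proof.
move=> Jmul Jm; have exJ : exists i, `[< J (P ^+ i) >] by exists m; apply/asboolP.
have [i /asboolP Ji i_min] := ex_minnP exJ; exists i => // x Jx.
suff: forall n, (n <= i)%N -> exists y, x = P ^+ n * y by apply.
elim=> [|n IHn] ni; first by exists x; rewrite mul1r.
have [y xE] := IHn (ltnW ni).
have [[z yE]|[z yz1]] := P_local y; first by exists z; rewrite xE yE exprSr mulrA.
have /asboolP/i_min : J (P ^+ n).
  have <- : x * z = P ^+ n by rewrite xE -mulrA yz1 mulr1.
  by rewrite mulrC; exact: Jmul.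
by rewrite leqNgt ni.
Qed.

Variables (R : comNzRingType) (iota : {rmorphism A -> R}) (X : R) (al be : A).

(* Coordinates in the triangular basis 1, X, X (X - al) of R over A. *)
Definition elt (c0 c1 c2 : A) : R :=
  iota c0 + iota c1 * X + iota c2 * (X * (X - iota al)).

Hypothesis elt_inj : forall c0 c1 c2 d0 d1 d2,
  elt c0 c1 c2 = elt d0 d1 d2 -> [/\ c0 = d0, c1 = d1 & c2 = d2].
Hypothesis elt_surj : forall y : R, exists c0 c1 c2, y = elt c0 c1 c2.
Hypothesis X_cubic : X * (X - iota al) * (X - iota be) = 0.

Lemma eltD c0 c1 c2 d0 d1 d2 :
  elt c0 c1 c2 + elt d0 d1 d2 = elt (c0 + d0) (c1 + d1) (c2 + d2).
Proof. by rewrite /elt !rmorphD /=; ring. Qed.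

Lemma eltB c0 c1 c2 d0 d1 d2 :
  elt c0 c1 c2 - elt d0 d1 d2 = elt (c0 - d0) (c1 - d1) (c2 - d2).
Proof. by rewrite /elt !rmorphB /=; ring. Qed.

Lemma elt0 : elt 0 0 0 = 0.
Proof. by rewrite /elt rmorph0; ring. Qed.

Lemma eltZ a c0 c1 c2 : iota a * elt c0 c1 c2 = elt (a * c0) (a * c1) (a * c2).
Proof. by rewrite /elt !rmorphM /=; ring. Qed.

(** This is the point of the basis: multiplication by X is bidiagonal, with diagonal 0, al, be. *)
Lemma eltX c0 c1 c2 : X * elt c0 c1 c2 = elt 0 (c0 + al * c1) (c1 + be * c2).
Proof.
apply/eqP; rewrite -subr_eq0 /elt !rmorphD !rmorphM rmorph0 /=; apply/eqP.
by transitivity (iota c2 * (X * (X - iota al) * (X - iota be)));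
  [ring|rewrite X_cubic mulr0].
Qed.

Lemma idealZ (I : set R) : is_ideal I -> forall a c0 c1 c2,
  I (elt c0 c1 c2) -> I (elt (a * c0) (a * c1) (a * c2)).
Proof. by case=> _ _ IM a c0 c1 c2; rewrite -eltZ; apply: IM. Qed.

Lemma idealB (I : set R) x y : is_ideal I -> I x -> I y -> I (x - y).
Proof. by case=> _ ID IM Ix Iy; apply: ID => //; rewrite -mulN1r; apply: IM. Qed.

(** X generates R as an A-algebra, so stability under A and X suffices. *)
Lemma idealP (I : set R) : I 0 -> (forall x y, I x -> I y -> I (x + y)) ->
  (forall a x, I x -> I (iota a * x)) -> (forall x, I x -> I (X * x)) -> is_ideal I.
Proof.
move=> I0 ID IZ IX; split=> // y x Ix; have [c0 [c1 [c2 ->]]] := elt_surj y.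
rewrite /elt !mulrDl -!mulrA mulrBl.
apply: (ID); first by apply: (ID); [exact: IZ|exact/IZ/IX].
apply/IZ/IX; apply: (ID); first exact: IX.
by rewrite -mulNr -rmorphN; apply: IZ.
Qed.

(* The A-lattice with Hermite basis (P^i, u, v), (0, P^j, w), (0, 0, P^k). *)
Definition lattice (i j k : nat) (u v w : A) : set R :=
  [set y | exists r0 r1 r2,
     y = elt (r0 * P ^+ i) (r0 * u + r1 * P ^+ j) (r0 * v + r1 * w + r2 * P ^+ k)].

Lemma latticeP i j k u v w c0 c1 c2 : lattice i j k u v w (elt c0 c1 c2) <->
  exists r0 r1 r2, [/\ c0 = r0 * P ^+ i, c1 = r0 * u + r1 * P ^+ j
                     & c2 = r0 * v + r1 * w + r2 * P ^+ k].
Proof.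
split=> [[r0 [r1 [r2 /elt_inj[-> -> ->]]]]|[r0 [r1 [r2 [-> -> ->]]]]];
  by exists r0, r1, r2.
Qed.

(** The hypotheses say X g0 = q g1 + y g2 and X g1 = al g1 + t g2 for the basis rows, while X g2 =
    be g2 always. *)
Lemma lattice_ideal i j k u v w q t y : P ^+ i + al * u = P ^+ j * q ->
  P ^+ j + (be - al) * w = P ^+ k * t -> u + be * v - q * w = P ^+ k * y ->
  is_ideal (lattice i j k u v w).
Proof.
move=> qE tE yE; apply: idealP.
- by exists 0, 0, 0; rewrite !mul0r !addr0 elt0.
- move=> _ _ [r0 [r1 [r2 ->]]] [s0 [s1 [s2 ->]]].
  by exists (r0 + s0), (r1 + s1), (r2 + s2); rewrite eltD; congr elt; ring.
- move=> a _ [r0 [r1 [r2 ->]]].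
  by exists (a * r0), (a * r1), (a * r2); rewrite eltZ; congr elt; ring.
- move=> _ [r0 [r1 [r2 ->]]].
  exists 0, (r0 * q + al * r1), (r0 * y + r1 * t + be * r2).
  rewrite eltX; congr elt; first by rewrite mul0r.
    by transitivity (r0 * (P ^+ j * q) + al * r1 * P ^+ j); [rewrite -qE|]; ring.
  transitivity (r0 * q * w + al * r1 * w + r0 * (P ^+ k * y) + r1 * (P ^+ k * t)
    + be * r2 * P ^+ k); last by ring.
  by rewrite -yE -tE; ring.
Qed.

Lemma lattice_ideal_inv i j k u v w : is_ideal (lattice i j k u v w) ->
  exists q t y, [/\ P ^+ i + al * u = P ^+ j * q,
    P ^+ j + (be - al) * w = P ^+ k * t & u + be * v - q * w = P ^+ k * y].
Proof.
case=> _ _ IM.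
have /(IM X) : lattice i j k u v w (elt (P ^+ i) u v).
  by apply/latticeP; exists 1, 0, 0; split; ring.
rewrite eltX => /latticeP[r0 [q [y [r0E qE yE]]]].
have {r0E}r0E : r0 = 0 by apply: (@expP_mul0 i); rewrite mulrC.
have /(IM X) : lattice i j k u v w (elt 0 (P ^+ j) w).
  by apply/latticeP; exists 0, 1, 0; split; ring.
rewrite eltX => /latticeP[s0 [s1 [t [s0E s1E tE]]]].
have {s0E}s0E : s0 = 0 by apply: (@expP_mul0 i); rewrite mulrC.
have {s1E}s1E : s1 = al.
  apply: (@expP_lreg j); rewrite mulrC [RHS]mulrC.
  by move: s1E; rewrite s0E mul0r !add0r => ->.
exists q, t, y; split; first by rewrite qE r0E; ring.
  have -> : P ^+ j + (be - al) * w = P ^+ j + be * w - al * w by ring.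
  by rewrite tE s0E s1E; ring.
by rewrite yE r0E; ring.
Qed.

(** Unitriangular change of basis: g0 = g0' + m1 g1' + m0 g2' and g1 = g1' + m2 g2'. *)
Lemma lattice_sub i j k u v w u' v' w' m0 m1 m2 :
  u = u' + P ^+ j * m1 -> w = w' + P ^+ k * m2 -> v = v' + m1 * w' + P ^+ k * m0 ->
  (lattice i j k u v w `<=` lattice i j k u' v' w')%classic.
Proof.
move=> -> -> -> _ [r0 [r1 [r2 ->]]].
by exists r0, (r0 * m1 + r1), (r0 * m0 + r1 * m2 + r2); congr elt; ring.
Qed.

Lemma lattice_eq i j k u v w u' v' w' m0 m1 m2 :
  u = u' + P ^+ j * m1 -> w = w' + P ^+ k * m2 -> v = v' + m1 * w' + P ^+ k * m0 ->
  lattice i j k u v w = lattice i j k u' v' w'.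
Proof.
move=> uE wE vE; apply/seteqP; split; first exact: lattice_sub uE wE vE.
(* These are the entries of the inverse unitriangular matrix. *)
by apply: (@lattice_sub _ _ _ _ _ _ _ _ _ (m1 * m2 - m0) (- m1) (- m2));
  rewrite ?uE ?vE ?wE; ring.
Qed.

Lemma lattice_inj i j k u v w i' j' k' u' v' w' :
  lattice i j k u v w = lattice i' j' k' u' v' w' ->
  [/\ i = i', j = j' & k = k'] /\
  exists m0 m1 m2, [/\ u = u' + P ^+ j * m1, w = w' + P ^+ k * m2
                      & v = v' + m1 * w' + P ^+ k * m0].
Proof.
(* Expressing the rows of one basis in the other gives one inequality per exponent; both directions
   together give equality. *)
wlog suff half : i j k u v w i' j' k' u' v' w' /
    lattice i j k u v w = lattice i' j' k' u' v' w' ->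
  [/\ (i' <= i)%N, (j' <= j)%N & (k' <= k)%N] /\
  (i = i' -> j = j' -> k = k' ->
  exists m0 m1 m2, [/\ u = u' + P ^+ j * m1, w = w' + P ^+ k * m2
                      & v = v' + m1 * w' + P ^+ k * m0]).
  move=> LE; have [[i'i j'j k'k] mE] := half _ _ _ _ _ _ _ _ _ _ _ _ LE.
  have [[ii' jj' kk'] _] := half _ _ _ _ _ _ _ _ _ _ _ _ (esym LE).
  have iE : i = i' by apply/eqP; rewrite eqn_leq ii'.
  have jE : j = j' by apply/eqP; rewrite eqn_leq jj'.
  have kE : k = k' by apply/eqP; rewrite eqn_leq kk'.
  by split=> //; apply: mE.
move=> LE.
have : lattice i j k u v w (elt (P ^+ i) u v).
  by apply/latticeP; exists 1, 0, 0; split; ring.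
rewrite LE => /latticeP[r0 [r1 [r2 [r0E uE vE]]]].
have : lattice i j k u v w (elt 0 (P ^+ j) w).
  by apply/latticeP; exists 0, 1, 0; split; ring.
rewrite LE => /latticeP[s0 [s1 [s2 [s0E s1E wE]]]].
have {s0E}s0E : s0 = 0 by apply: (@expP_mul0 i'); rewrite mulrC.
have : lattice i j k u v w (elt 0 0 (P ^+ k)).
  by apply/latticeP; exists 0, 0, 1; split; ring.
rewrite LE => /latticeP[t0 [t1 [t2 [t0E t1E t2E]]]].
have {t0E}t0E : t0 = 0 by apply: (@expP_mul0 i'); rewrite mulrC.
rewrite s0E mul0r add0r in s1E; rewrite s0E mul0r add0r in wE.
have {t1E}t1E : t1 = 0.
  by apply: (@expP_mul0 j'); rewrite mulrC t1E t0E mul0r add0r.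
rewrite t0E t1E !mul0r !add0r in t2E.
split.
  by split; [move: r0E|move: s1E|move: t2E]; rewrite mulrC => /expP_leq.
move=> iE jE kE; subst i' j' k'.
(* Equal pivots force diagonal coefficients 1, and the off-diagonal ones are the required m0, m1,
   m2. *)
have {r0E}r0E : r0 = 1 by apply: (@expP_lreg i); rewrite mulr1 mulrC.
have {s1E}s1E : s1 = 1 by apply: (@expP_lreg j); rewrite mulr1 mulrC.
by exists r2, r1, s2; rewrite {1}uE {1}vE {1}wE r0E s1E; split; ring.
Qed.

(* By pigeonhole P^m y and P^n y lie in the same coset for some m < n, and
   1 - P^(n-m) is a unit. *)
Lemma ideal_expP (I : set R) : full_ideal I -> forall y, exists m, I (iota (P ^+ m) * y).
Proof.
move=> [Iideal fin] y; have [I0 _ IM] := Iideal.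
pose f n : set R := [set z | I (z - iota (P ^+ n) * y)]%classic.
have [m [n [mn fmn]]] : exists m n, (m < n)%N /\ f m = f n.
  apply: contrapT => noeq; move/finite_setPn: fin; apply.
  have f_inj : injective f.
    by move=> m n fmn; case: (ltngtP m n) => // lt; case: noeq; [exists m, n|exists n, m].
  rewrite -(card_le_eql (inj_card_eq (in2W f_inj))).
  apply: subset_card_le.
  by move=> _ [n _ <-]; exists (iota (P ^+ n) * y).
have : f m (iota (P ^+ m) * y) by rewrite /f /= subrr.
have [l nE] : exists l, n = (m + l.+1)%N by exists (n - m.+1)%N; rewrite addnS -addSn subnKC.
rewrite fmn /f /= -mulrBl -rmorphB /= nE exprD exprS -[P ^+ m in X in X - _]mulr1 -mulrBr.
move=> Imn; exists m.
have [[z zE]|[z z1]] := P_local (1 - P * P ^+ l).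
  have /P_dvd_int : (1%:Z)%:~R = P * (z + P ^+ l).
    by rewrite mulrDr -zE; ring.
  by rewrite dvdz1 /= => /eqP p1; move: p_prime; rewrite p1.
have -> : P ^+ m = z * (P ^+ m * (1 - P * P ^+ l)).
  by rewrite mulrCA [z * _]mulrC z1 mulr1.
by rewrite rmorphM -mulrA; apply: IM.
Qed.

(** Gaussian elimination: the leading coordinates of the elements of I with no, one or two initial
    zeros form three ideals of A, each generated by a power of P. *)
Lemma full_ideal_lattice (I : set R) : full_ideal I ->
  exists i j k u v w, I = lattice i j k u v w.
Proof.
move=> Ifull; have Iideal := Ifull.1.
have [m0] := ideal_expP Ifull (elt 1 0 0); rewrite eltZ mulr1 mulr0 => I0.
have [m1] := ideal_expP Ifull (elt 0 1 0); rewrite eltZ mulr1 mulr0 => I1.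
have [m2] := ideal_expP Ifull (elt 0 0 1); rewrite eltZ mulr1 mulr0 => I2.
have [||i [u [v Ii]] iP] := @uniformizer (fun c => exists d e, I (elt c d e)) m0.
- by move=> r c [d [e /(idealZ Iideal r)]]; exists (r * d), (r * e).
- by exists 0, 0.
have [||j [w Ij] jP] := @uniformizer (fun c => exists e, I (elt 0 c e)) m1.
- by move=> r c [e /(idealZ Iideal r)]; rewrite mulr0; exists (r * e).
- by exists 0.
have [||k Ik kP] := @uniformizer (fun c => I (elt 0 0 c)) m2.
- by move=> r c /(idealZ Iideal r); rewrite mulr0.
- by [].
exists i, j, k, u, v, w; apply/seteqP; split=> [x|_ [r0 [r1 [r2 ->]]]].
  have [c0 [c1 [c2 ->]]] := elt_surj x => Ic.
  have [|r0 r0E] := iP c0; first by exists c1, c2.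
  have := idealB Iideal Ic (idealZ Iideal r0 Ii); rewrite eltB mulrC -r0E subrr => Ic'.
  have [|r1 r1E] := jP (c1 - r0 * u); first by exists (c2 - r0 * v).
  have := idealB Iideal Ic' (idealZ Iideal r1 Ij).
  rewrite eltB mulr0 subrr [r1 * _]mulrC -r1E subrr => /kP[r2 r2E].
  apply/latticeP; exists r0, r1, r2; split; first by rewrite mulrC.
    by rewrite [r1 * _]mulrC -r1E; ring.
  by rewrite [r2 * _]mulrC -r2E; ring.
have [_ ID _] := Iideal.
have := ID _ _ (ID _ _ (idealZ Iideal r0 Ii) (idealZ Iideal r1 Ij)) (idealZ Iideal r2 Ik).
by rewrite !eltD !mulr0 !addr0.
Qed.

Lemma lattice_index i j k u v w : is_ideal (lattice i j k u v w) ->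
  has_index (lattice i j k u v w) (p ^ (i + j + k)).
Proof.
set I := lattice _ _ _ _ _ _ => Iideal.
pose T : finType := ('I_(p ^ i) * 'I_(p ^ j) * 'I_(p ^ k))%type.
have -> : (p ^ (i + j + k))%N = #|[pred _ : T | true]|.
  by rewrite -[RHS]/#|T| !card_prod !card_ord !expnD.
pose rep (m : T) := elt (m.1.1 : nat)%:R (m.1.2 : nat)%:R (m.2 : nat)%:R.
apply: (@card_eq_enum T _ _ _ (fun m => [set y | I (y - rep m)]%classic)).
  move=> [[m0 m1] m2] [[n0 n1] n2] _ _ /= coset_eq.
  have : [set y | I (y - rep (m0, m1, m2))]%classic (rep (m0, m1, m2)).
    by rewrite /= subrr; case: Iideal.
  rewrite coset_eq /= /rep eltB => /latticeP[r0 [r1 [r2 [r0E r1E r2E]]]].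
  have mn0 : m0 = n0 :> nat.
    by apply: (expP_residue_inj _ _ (etrans r0E (mulrC _ _))).
  rewrite mn0 subrr in r0E.
  have {r0E}r0E : r0 = 0 by apply: (@expP_mul0 i); rewrite mulrC.
  rewrite r0E mul0r add0r in r1E.
  have mn1 : m1 = n1 :> nat.
    by apply: (expP_residue_inj _ _ (etrans r1E (mulrC _ _))).
  rewrite mn1 subrr in r1E.
  have {r1E}r1E : r1 = 0 by apply: (@expP_mul0 j); rewrite mulrC.
  rewrite r0E r1E !mul0r !add0r in r2E.
  have mn2 : m2 = n2 :> nat.
    by apply: (expP_residue_inj _ _ (etrans r2E (mulrC _ _))).
  by congr (_, _, _); apply: val_inj.
move=> S; split=> [[x _ <-]|[m _ <-]]; last by exists (rep m).
have [c0 [c1 [c2 xE]]] := elt_surj x.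
(* Reduction goes from the first coordinate to the last, since subtracting a multiple of a row
   alters the later coordinates. *)
have [m0 m0P [r0 r0E]] := expP_residue i c0.
have [m1 m1P [r1 r1E]] := expP_residue j (c1 - r0 * u).
have [m2 m2P [r2 r2E]] := expP_residue k (c2 - r0 * v - r1 * w).
exists (Ordinal m0P, Ordinal m1P, Ordinal m2P) => //.
have Ix : I (x - rep (Ordinal m0P, Ordinal m1P, Ordinal m2P)).
  rewrite xE /rep eltB; apply/latticeP; exists r0, r1, r2; split=> /=.
  - by rewrite r0E; ring.
  - by rewrite -[c1](subrK (r0 * u)) r1E; ring.
  - by rewrite -[c2](subrK (r0 * v)) -[c2 - _](subrK (r1 * w)) r2E; ring.
apply/seteqP; split=> y /= Iy.
  by have := idealB Iideal Iy Ix; rewrite opprB addrA subrK.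
by case: Iideal => _ ID _; have := ID _ _ Iy Ix; rewrite addrA subrK.
Qed.

(** * Digits of a lattice stable under X *)

Variables (a b : int) (a' b' c' : A).
Hypotheses (alE : al = P * a%:~R) (beE : be = P * b%:~R).
Hypotheses (a'E : a%:~R * a' = 1) (b'E : b%:~R * b' = 1) (c'E : (b - a)%:~R * c' = 1).

Lemma unitKl (x x' y : A) : x * x' = 1 -> y = x' * (x * y).
Proof. by move=> xx'; rewrite mulrCA mulrA xx' mul1r. Qed.

(** Excludes an exponent 0 followed by a positive one, where stability would express 1 as a multiple
    of P. *)
Lemma P_neq_unit (y z : A) : P * y + P * z <> 1.
Proof.
rewrite -mulrDr => /esym yz; have := @P_dvd_int 1 _ yz.
by rewrite dvdz1 /= => /eqP p1; move: p_prime; rewrite p1.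
Qed.

Lemma res_inj (s t : 'F_p) (y : A) : (s : nat)%:R - (t : nat)%:R = P * y -> s = t.
Proof.
move=> stE; apply: val_inj; apply: (@expP_residue_inj 1 _ _ y) => //.
- by rewrite expn1 -[ltnRHS](Fp_cast p_prime) ltn_ord.
- by rewrite expn1 -[ltnRHS](Fp_cast p_prime) ltn_ord.
Qed.

(** The common shape of the entries u, w, v: a unit times (digit P^n - z), taken modulo P^(n+1).
    Multiplying by [x] and cancelling P^n isolates the digit. *)
Lemma digit_inj n (x x' z m : A) (s t : 'F_p) : x * x' = 1 ->
  x' * ((s : nat)%:R * P ^+ n - z) = x' * ((t : nat)%:R * P ^+ n - z) + P ^+ n.+1 * m ->
  s = t.
Proof.
move=> xx' /(congr1 ( *%R x)); rewrite [RHS]mulrDr ![x * (x' * _)]mulrA xx' !mul1r => stE.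
apply: (@res_inj _ _ (x * m)); apply: (@expP_lreg n).
rewrite mulrBr ![P ^+ n * _%:R]mulrC; apply/eqP; rewrite subr_eq; apply/eqP.
by apply: (@addIr _ (- z)); rewrite stE exprS; ring.
Qed.

(** Solves P^i + al u = P^j s after division by P; [w_of] likewise solves P^j + (be - al) w = P^k t.
    An entry taken modulo P^0 is set to 0. *)
Definition u_of (i j : nat) (s : 'F_p) : A :=
  if j is j'.+1 then a' * ((s : nat)%:R * P ^+ j' - P ^+ i.-1) else 0.

Definition w_of (j k : nat) (t : 'F_p) : A :=
  if k is k'.+1 then c' * ((t : nat)%:R * P ^+ k' - P ^+ j.-1) else 0.

(** Solves u + be v - s w = P^k r, where u - s w is a' c' times the obstruction; the integer
    division by p is exact for valid digits. *)
Definition v_of (i j k : nat) (s t r : 'F_p) : A :=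
  if k is k'.+1 then
    b' * ((r : nat)%:R * P ^+ k' - a' * c' * (obstruction a b i j k s t %/ p%:Z)%Z%:~R)
  else 0.

Definition lattice_of (i j k : nat) (s t r : 'F_p) : set R :=
  lattice i j k (u_of i j s) (v_of i j k s t r) (w_of j k t).

Lemma obstructionE i j k s t :
  u_of i j.+1 s - (s : nat)%:R * w_of j.+1 k.+1 t =
  a' * c' * (obstruction a b i j.+1 k.+1 s t)%:~R.
Proof.
rewrite /u_of /w_of /obstruction !rmorphB !rmorphM !rmorphXn /=.
have c'E' : (b%:~R - a%:~R) * c' = 1 by rewrite -rmorphB.
rewrite -[p%:~R]/P -[(s : nat)%:~R]/((s : nat)%:R) -[(t : nat)%:~R]/((t : nat)%:R).
apply/eqP; rewrite -subr_eq0; apply/eqP.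
move: (s : nat)%:R (t : nat)%:R (P ^+ j) (P ^+ k) (P ^+ i.-1) => S T J K I.
(* The difference of the two sides is a combination of the relations (b - a) c' = 1 and a a' = 1. *)
transitivity ((1 - (b%:~R - a%:~R) * c') * a' * (S * J - I)
  + (1 - a%:~R * a') * c' * (S * J - S * T * K)); first by ring.
by rewrite a'E c'E' !subrr !mul0r addr0.
Qed.

Lemma u_ofE i j s :
  P ^+ i.+1 + al * u_of i.+1 j.+1 s = P ^+ j.+1 * (s : nat)%:R.
Proof.
rewrite alE /u_of /= !exprS.
transitivity (P * P ^+ i + (a%:~R * a') * P * ((s : nat)%:R * P ^+ j - P ^+ i)).
  by ring.
by rewrite a'E; ring.
Qed.

Lemma w_ofE j k t :
  P ^+ j.+1 + (be - al) * w_of j.+1 k.+1 t = P ^+ k.+1 * (t : nat)%:R.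
Proof.
rewrite alE beE -mulrBr -rmorphB /w_of /= !exprS.
transitivity (P * P ^+ j + ((b - a)%:~R * c') * P * ((t : nat)%:R * P ^+ k - P ^+ j)).
  by ring.
by rewrite c'E; ring.
Qed.

Lemma v_ofE i j k s t r : (p%:Z %| obstruction a b i j k.+1 s t)%Z ->
  a' * c' * (obstruction a b i j k.+1 s t)%:~R + be * v_of i j k.+1 s t r
  = P ^+ k.+1 * (r : nat)%:R.
Proof.
move=> /dvdzP[m mE]; rewrite beE /v_of mE mulzK; last by rewrite -lt0n prime_gt0.
rewrite rmorphM /= -[p%:~R]/P exprS.
transitivity (a' * c' * (m%:~R * P) + (b%:~R * b') * P *
  ((r : nat)%:R * P ^+ k - a' * c' * m%:~R)); first by ring.
by rewrite b'E; ring.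
Qed.

Lemma valid_lattice_ideal i j k s t r : valid_digits a b i j k s t r ->
  is_ideal (lattice_of i j k s t r).
Proof.
rewrite /lattice_of; case: k => [/and3P[_ _ ij]|k /and3P[]].
  have [q qE] : exists q, P ^+ i + al * u_of i j s = P ^+ j * q.
    case: j ij => [_|j]; first by exists (P ^+ i + al * u_of i 0 s); rewrite mul1r.
    by case: i => // i _; exists (s : nat)%:R; exact: u_ofE.
  (* As k = 0, the other two conditions are solved by taking their left sides for t and y. *)
  by apply: (lattice_ideal qE); rewrite mul1r.
case: i j => // i [] // j _ _ pM.
apply: lattice_ideal (u_ofE i j s) (w_ofE j k t) _.
by rewrite addrAC obstructionE v_ofE.
Qed.

Lemma ideal_lattice_of i j k u v w : is_ideal (lattice i j k u v w) ->
  exists s t r, valid_digits a b i j k s t r /\ lattice i j k u v w = lattice_of i j k s t r.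
Proof.
(* For j > 0 the first stability condition forces i > 0 and fixes u modulo P^j up to the residue of
   q. *)
have uP i' j' u' q : P ^+ i' + al * u' = P ^+ j'.+1 * q ->
    (0 < i')%N /\ exists (s : 'F_p) m, u' = u_of i' j'.+1 s + P ^+ j'.+1 * m.
  case: i' => [|i'] uE.
    case: (@P_neq_unit (P ^+ j' * q) (- (a%:~R * u'))).
    by rewrite mulrA -exprS -uE alE; ring.
  split=> //; have [s [q' qE]] := P_residue q; exists s, (a' * q').
  have : P * (a%:~R * u') = P * (P ^+ j' * q - P ^+ i').
    by rewrite mulrA -alE mulrBr mulrA -!exprS -uE; ring.
  by move/P_lreg => auE; rewrite [LHS](unitKl _ a'E) auE qE /u_of exprS; ring.
case: k => [|k] Iideal.
  case: j Iideal => [|j] Iideal.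
    exists 0, 0, 0; split=> //.
    by apply: (@lattice_eq _ _ _ _ _ _ _ _ _ v u w); rewrite /=; ring.
  have [q [_ [_ [/uP[i0 [s [m uE]]] _ _]]]] := lattice_ideal_inv Iideal.
  exists s, 0, 0; split; first by rewrite /valid_digits !eqxx.
  by apply: (@lattice_eq _ _ _ _ _ _ _ _ _ v m w); rewrite ?uE /=; ring.
case: j Iideal => [|j] Iideal.
  have [_ [t [_ [_ tE _]]]] := lattice_ideal_inv Iideal.
  case: (@P_neq_unit (P ^+ k * t) (- ((b%:~R - a%:~R) * w))).
  by rewrite mulrA -exprS -tE alE beE; ring.
have [q [t0 [_ [/uP[i0 [s [m1 uE]]] tE _]]]] := lattice_ideal_inv Iideal.
have [t [t' t0E]] := P_residue t0.
have wE : w = w_of j.+1 k.+1 t + P ^+ k.+1 * (c' * t').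
  have : P * ((b - a)%:~R * w) = P * (P ^+ k * t0 - P ^+ j).
    by rewrite mulrA rmorphB mulrBr -alE -beE mulrBr mulrA -!exprS -tE; ring.
  by move/P_lreg => cwE; rewrite [LHS](unitKl _ c'E) cwE t0E /w_of exprS; ring.
(* Normalizing u subtracts m1 times the second row, which changes v into [v1]. *)
set v1 := v - m1 * w_of j.+1 k.+1 t.
have LE : lattice i j.+1 k.+1 u v w
    = lattice i j.+1 k.+1 (u_of i j.+1 s) v1 (w_of j.+1 k.+1 t).
  by apply: (@lattice_eq _ _ _ _ _ _ _ _ _ 0 m1 (c' * t')); rewrite // /v1; ring.
rewrite LE in Iideal *.
case: i i0 uE LE Iideal => // i _ uE LE Iideal.
have [q1 [t1 [y1 [q1E _ yE]]]] := lattice_ideal_inv Iideal.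
move: q1E; rewrite u_ofE => /expP_lreg q1E; rewrite -q1E addrAC obstructionE in yE.
(* Multiplied by a (b - a), the third stability condition shows that P divides the obstruction. *)
have pM : (p%:Z %| obstruction a b i.+1 j.+1 k.+1 s t)%Z.
  apply: (@P_dvd_int _ (a%:~R * (b - a)%:~R * (P ^+ k * y1 - b%:~R * v1))).
  transitivity (a%:~R * (b - a)%:~R * (P ^+ k.+1 * y1 - be * v1)).
    rewrite -yE addrK.
    transitivity ((a%:~R * a') * ((b - a)%:~R * c') *
      (obstruction a b i.+1 j.+1 k.+1 s t)%:~R : A); last by ring.
    by rewrite a'E c'E !mul1r.
  by rewrite beE exprS; ring.
have [r [y' y1E]] := P_residue y1.
exists s, t, r; split; first by rewrite /= pM.
apply: (@lattice_eq _ _ _ _ _ _ _ _ _ (b' * y') 0 0);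
  rewrite ?mulr0 ?addr0 ?mul0r //.
(* Both [v1] and [v_of] solve the third condition, with right sides P^(k+1) y1 and P^(k+1) r, where
   y1 - r = P y'. *)
have : be * (v1 - v_of i.+1 j.+1 k.+1 s t r) = P * (P ^+ k.+1 * y').
  rewrite mulrBr.
  have := v_ofE r pM; have := yE; move: (_ * _%:~R : A) => M.
  move=> /(canRL (addKr _)) -> /(canRL (addKr _)) ->.
  by rewrite y1E; ring.
rewrite beE -mulrA => /P_lreg vE; rewrite [RHS]addrC; apply: (canRL (subrK _)).
by rewrite addr0 [LHS](unitKl _ b'E) vE; ring.
Qed.

Lemma lattice_of_inj i j k s t r i' j' k' s' t' r' :
  valid_digits a b i j k s t r -> valid_digits a b i' j' k' s' t' r' ->
  lattice_of i j k s t r = lattice_of i' j' k' s' t' r' ->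
  [/\ i = i', j = j' & k = k'] /\ [/\ s = s', t = t' & r = r'].
Proof.
move=> V V' /lattice_inj[[iE jE kE] [m0 [m1 [m2 [uE wE vE]]]]].
subst i' j' k'; split=> //.
have suE j1 : j = j1.+1 -> s = s'.
  by move=> jE; move: uE; rewrite jE; exact: digit_inj a'E.
have twE k1 : k = k1.+1 -> t = t'.
  by move=> kE; move: wE; rewrite kE; exact: digit_inj c'E.
case: k V V' uE wE vE twE => [|k].
  (* For k = 0 the normalization to 0 settles t and r, and also s when j = 0. *)
  move=> /and3P[/eqP-> /eqP-> sj] /and3P[/eqP-> /eqP-> sj'] _ _ _ _; split=> //.
  by case: j sj sj' suE => [/eqP-> /eqP->|j _ _ /(_ j)->].
case: j suE => [|j] suE; first by case/and3P.
move=> _ _ uE wE vE /(_ k erefl) tE; have sE := suE j erefl.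
subst s' t'; split=> //.
(* With s = s' the entries u coincide, so v is determined modulo P^k itself and yields r. *)
have m1E : m1 = 0.
  by apply: (@expP_mul0 j.+1); apply: (addrI (u_of i j.+1 s)); rewrite -uE addr0.
by move: vE; rewrite m1E mul0r addr0; exact: digit_inj b'E.
Qed.

(** * Full ideals of index p^n correspond to digit data *)

Lemma has_index_inj (I : set R) m n : has_index I m -> has_index I n -> m = n.
Proof. by move=> /card_esym Im In; apply/card_eq_II; exact: card_eq_trans Im In. Qed.

Lemma lattice_of_full i j k s t r : valid_digits a b i j k s t r ->
  full_ideal (lattice_of i j k s t r) /\
  has_index (lattice_of i j k s t r) (p ^ (i + j + k)).
Proof.
move=> V; have Iideal := valid_lattice_ideal V.
have ind := lattice_index Iideal; do 2 split=> //.
by apply/finite_setP; exists (p ^ (i + j + k))%N.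
Qed.

Lemma full_ideal_lattice_of (I : set R) : full_ideal I ->
  exists i j k s t r, valid_digits a b i j k s t r /\ I = lattice_of i j k s t r.
Proof.
move=> Ifull; have [i [j [k [u [v [w IE]]]]]] := full_ideal_lattice Ifull.
have := Ifull.1; rewrite IE => /ideal_lattice_of[s [t [r [V ->]]]].
by exists i, j, k, s, t, r.
Qed.

Lemma zeta_params : zeta_series R p (fun n => #|@params p a b n|).
Proof.
split=> [I /full_ideal_lattice_of[i [j [k [s [t [r [V ->]]]]]]]|n].
  by exists (i + j + k)%N; have [] := lattice_of_full V.
apply: (@card_eq_enum _ _ (@params p a b n) _ (fun x =>
  lattice_of x.1.1 x.1.2 (n - (x.1.1 + x.1.2)) x.2.1.1 x.2.1.2 x.2.2)).
  move=> [[i j] [[s t] r]] [[i' j'] [[s' t'] r']].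
  rewrite !unfold_in /= => /andP[_ V] /andP[_ V'] /(lattice_of_inj V V').
  move=> [[ii jj _] /= [-> -> ->]].
  by rewrite (val_inj ii) (val_inj jj).
move=> I; split=> [[Ifull Iind]|[x]]; last first.
  rewrite unfold_in => /andP[ijn V] <-; have [full ind] := lattice_of_full V.
  by split=> //; move: ind; rewrite subnKC.
have [i [j [k [s [t [r [V IE]]]]]]] := full_ideal_lattice_of Ifull.
have : (p ^ (i + j + k) = p ^ n)%N.
  by apply: has_index_inj Iind; rewrite IE; have [] := lattice_of_full V.
move/eqP; rewrite eqn_exp2l ?prime_gt1 // => /eqP ijkn.
have i_lt : (i < n.+1)%N by rewrite ltnS -ijkn -addnA leq_addr.
have j_lt : (j < n.+1)%N by rewrite ltnS -ijkn addnAC leq_addl.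
have kE : (n - (i + j) = k)%N by rewrite -ijkn addKn.
exists (Ordinal i_lt, Ordinal j_lt, (s, t, r)); last by rewrite /= kE.
by rewrite unfold_in /params /= kE -{1}ijkn leq_addr.
Qed.

End IdealCount.

(** * Coordinates on the quotient ring *)

Section CubicQuotient.
Variables (A : comNzRingType) (al be : A).
Local Notation h := ('X * ('X - al%:P) * ('X - be%:P)).
Local Notation R := {poly %/ h}.
Local Notation iota := (in_qpoly h \o polyC : {rmorphism A -> R}).
Local Notation qelt := (elt iota (in_qpoly h 'X) al).

Lemma cubic_monic : h \is monic.
Proof. by rewrite !(rpredM, monicX, monicXsubC). Qed.

Lemma size_cubic : size h = 4%N.
Proof.
rewrite size_Mmonic ?monicXsubC //; last first.
  by rewrite monic_neq0 // rpredM ?monicX ?monicXsubC.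
rewrite size_Mmonic ?monicXsubC ?monic_neq0 ?monicX //.
by rewrite size_polyX !size_XsubC.
Qed.

Lemma mk_monic_split_cubic : mk_monic h = h.
Proof. by rewrite /mk_monic size_cubic cubic_monic. Qed.

Lemma coef_quadratic (c0 c1 c2 : A) j :
  (c0%:P + c1 *: 'X + c2 *: 'X^2)`_j = [:: c0; c1; c2]`_j.
Proof.
by case: j => [|[|[|j]]]; rewrite !coefE /= ?mulr0 ?mulr1 ?addr0 ?add0r // nth_nil.
Qed.

Lemma qeltE c0 c1 c2 :
  qelt c0 c1 c2 = in_qpoly h (c0%:P + (c1 - al * c2) *: 'X + c2 *: 'X^2).
Proof.
have -> : c0%:P + (c1 - al * c2) *: 'X + c2 *: 'X^2
    = c0%:P + c1%:P * 'X + c2%:P * ('X * ('X - al%:P)) :> {poly A}.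
  by rewrite -!mul_polyC polyCB polyCM; ring.
by rewrite /elt !in_qpolyD !in_qpolyM rmorphB.
Qed.

(** A polynomial of degree at most 2 is its own remainder, so coordinates can be read off from
    coefficients. *)
Lemma val_qelt c0 c1 c2 :
  qelt c0 c1 c2 = c0%:P + (c1 - al * c2) *: 'X + c2 *: 'X^2 :> {poly A}.
Proof.
rewrite qeltE in_qpoly_small // mk_monic_split_cubic size_cubic ltnS.
by apply/leq_sizeP => j j3; rewrite coef_quadratic nth_default.
Qed.

Lemma qelt_inj c0 c1 c2 d0 d1 d2 :
  qelt c0 c1 c2 = qelt d0 d1 d2 -> [/\ c0 = d0, c1 = d1 & c2 = d2].
Proof.
move=> /(congr1 (fun y : R => y : {poly A})); rewrite !val_qelt => /polyP E.
have := (E 0%N, E 1%N, E 2); rewrite !coef_quadratic /= => -[[-> c1E] c2E].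
by move: c1E; rewrite c2E => /addIr ->.
Qed.

Lemma qelt_surj (y : R) : exists c0 c1 c2, y = qelt c0 c1 c2.
Proof.
pose q : {poly A} := y.
have size_q : (size q <= 3)%N.
  by rewrite -ltnS -size_cubic -[in leqRHS]mk_monic_split_cubic size_mk_monic.
exists q`_0, (q`_1 + al * q`_2), q`_2; apply: val_inj; rewrite [RHS]val_qelt addrK.
apply/polyP => j; rewrite coef_quadratic; case: j => [|[|[|j]]] //=.
by rewrite nth_nil nth_default // (leq_trans size_q).
Qed.

Lemma in_qpoly_cubic :
  in_qpoly h 'X * (in_qpoly h 'X - iota al) * (in_qpoly h 'X - iota be) = 0.
Proof.
transitivity (in_qpoly h h); first by rewrite !in_qpolyM !rmorphB.
apply: val_inj; rewrite /= [in X in Pdiv.CommonRing.rmodp _ X]mk_monic_split_cubic.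
exact: Pdiv.RingMonic.rmodpp cubic_monic.
Qed.

End CubicQuotient.

(** * The zeta function of the cubic quotient *)

Theorem proposition4p2 (p : nat) (p_prime : prime p) (alpha beta : int)
    (distinct : uniq [:: 0; alpha; beta])
    (ords : (Zloc_ord (alpha%:~R : Zloc p_prime),
             Zloc_ord (beta%:~R : Zloc p_prime),
             Zloc_ord ((beta - alpha)%:~R : Zloc p_prime)) = (1, 1, 1)%N) :
  exists z : nat -> nat,
    zeta_series {poly %/ cubic p_prime alpha beta} p z /\
    fps_mul (fps_of_poly ((1 - 'X) ^+ 3)) (fun n => (z n)%:Z) =
    fps_of_poly
      (p%:R ^+ 3 *: 'X^6 - (2 * p%:R ^+ 2) *: 'X^5 + (p%:R ^+ 2 + p%:R) *: 'X^4
       + (p%:R ^+ 2 - 2 * p%:R) *: 'X^3 + (p%:R + 1) *: 'X^2 - 2 *: 'X + 1).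
Proof.
case: ords => /Zloc_ord1[a alE [a' a'E]] /Zloc_ord1[b beE [b' b'E]].
move=> /Zloc_ord1[c caE [c' c'E]].
have cE : c = b - a.
  apply: (@mulfI _ p%:Z); first by rewrite -lt0n prime_gt0.
  by rewrite -caE alE beE mulrBr.
rewrite cE in c'E.
(* An integer invertible in Z_p is nonzero mod p: otherwise p would divide 1. *)
have unitF (m : int) (m' : Zloc p_prime) : m%:~R * m' = 1 -> (m%:~R : 'F_p) != 0.
  move=> mm'; rewrite -(dvdz_pcharf (pchar_Fp p_prime)); apply/negP => /dvdzP[n mE].
  have /Zloc_natp_dvd_int : (1%:Z)%:~R = p%:R * (n%:~R * m') :> Zloc p_prime.
    by rewrite mulrA [p%:R * _]mulrC -[p%:R]/(p%:~R) -rmorphM -mE mm'.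
  by rewrite dvdz1 /= => /eqP p1; have := prime_gt1 p_prime; rewrite p1.
exists (fun n => #|@params p a b n|); split; last first.
  exact: (params_series p_prime (unitF _ _ a'E) (unitF _ _ b'E) (unitF _ _ c'E)).
pose al : Zloc p_prime := alpha%:~R; pose be : Zloc p_prime := beta%:~R.
apply: (zeta_params p_prime (@Zloc_natp_lreg _ p_prime) (@Zloc_natp_dvd_int _ p_prime)
  (@Zloc_residue _ p_prime) (@Zloc_local _ p_prime) (@qelt_inj _ al be)
  (@qelt_surj _ al be) (in_qpoly_cubic al be) _ _ a'E b'E c'E).
- by rewrite /al alE rmorphM.
- by rewrite /be beE rmorphM.
Qed.
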